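(* Let $(X,d,A)$ be a metric pair with $A\neq\varnothing$ such that $(X/A,\overline d_1,[A])$ is uniformly discrete, and let $\psi:[0,\infty)\to[0,\infty)$ satisfy $\psi(0)=0$ and $\sum_{x,y\in X\setminus A,\,x\ne y}\psi(\overline d_1(x,y))<\infty$. Then there exists a unique convolution semigroup of probability measures $(p_t^\psi)_{t\ge0}$ on $K(X,A)$ such that, for every $t\ge 0$ and every $\theta\in\widehat{K(X,A)}$, $$\widehat{p_t^\psi}(\theta)=e^{-t\lambda^\psi(\theta)}.$$
   Context: Metric pair: $(X,d)$ is a metric space and $A\subseteq X$ is nonempty. Put $d(x,A)=\inf_{a\in A}d(x,a)$ and $d_1(x,y)=\min(d(x,y),d(x,A)+d(y,A))$. $X/A$ is the quotient collapsing $A$ to a basepoint $[A]$, and $\overline d_1$ is the metric on $X/A$ induced by $d_1$ (so $\overline d_1(x,y)=d_1(x,y)$ and $\overline d_1(x,[A])=d(x,A)$ for $x,y\in X\setminus A$). Uniformly discrete means: there is $c>0$ with $\overline d_1(u,v)\ge c$ for all distinct $u,v\in X/A$. $D(X,A)$ is the free commutative monoid on $X$ modulo the submonoid generated by $A$; $K(X,A)$ is its Grothendieck group, identified with $\bigoplus_{x\in X\setminus A}\mathbb Z e_x$ and regarded as a discrete abelian group, with compact dual $\widehat{K(X,A)}$ of characters into $\mathbb T$. The Fourier transform of a probability measure $p$ is $\widehat p(\theta)=\sum_{g}p(g)\overline{\theta(g)}$. Sums over possibly uncountable index sets of nonnegative terms are suprema of finite partial sums. Define $\nu:K(X,A)\setminus\{0\}\to[0,\infty)$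 by $\nu(e_x-e_y)=\frac12\psi(\overline d_1(x,y))$ for $x,y\in X\setminus A$, $x\ne y$, and $\nu(\kappa)=0$ for all other $\kappa$; and $\lambda^\psi(\theta)=\sum_{\kappa\in K(X,A)\setminus\{0\}}\nu(\kappa)\bigl(1-\Re\,\theta(\kappa)\bigr)$ for $\theta\in\widehat{K(X,A)}$. A convolution semigroup of probability measures is a family $(p_t)_{t\ge0}$ with $p_0=\delta_0$ and $p_{s+t}=p_s*p_t$ for $s,t\ge0$. *)

(* Defs.v *)
From HB Require Import structures.
From mathcomp Require Import all_boot all_order all_algebra.
From mathcomp Require Import finmap.
From mathcomp Require Import all_classical all_reals all_analysis.
From mathcomp.analysis.showcase Require summability.
From mathcomp.real_closed Require Import complex.
From mathcomp.multinomials Require Import freeg.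

Set Implicit Arguments.
Unset Strict Implicit.
Unset Printing Implicit Defensive.

Import Order.TTheory GRing.Theory Num.Theory.
Import numFieldNormedType.Exports.

Local Open Scope classical_set_scope.
Local Open Scope ring_scope.

Section metric_pair.
Context {R : realType} {X : metricType R} (A : set X).

Definition dist_to (x : X) : R := inf [set mdist x a | a in A].

Definition d1 (x y : X) : R :=
  Num.min (mdist x y) (dist_to x + dist_to y).

(* [X / A] as a set: [None] is the collapsed point [A], and [Some x] is the
   class of [x \notin A]. *)
Definition collapse : Type := option (~` A).

Definition to_collapse (x : X) : collapse :=
  if pselect ((~` A) x) is left nAx then Some (exist _ x (mem_set nAx))
  else None.

Definition d1bar (u v : collapse) : R :=
  match u, v with
  | Some x, Some y => d1 (val x) (val y)
  | Some x, None => dist_to (val x)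
  | None, Some y => dist_to (val y)
  | None, None => 0
  end.

Definition uniformly_discrete : Prop :=
  exists2 c : R, 0 < c & forall u v : collapse, u <> v -> c <= d1bar u v.

Let dist_to_lb x : lbound [set mdist x a | a in A] 0.
Proof. by move=> _ [a _ <-]; exact: mdist_ge0. Qed.

Lemma dist_to_ge0 x : A !=set0 -> 0 <= dist_to x.
Proof.
by move=> [a Aa]; apply: lb_le_inf; [exists (mdist x a), a | exact: dist_to_lb].
Qed.

Lemma dist_to_le x a : A a -> dist_to x <= mdist x a.
Proof. by move=> Aa; apply: ge_inf; [exists 0; exact: dist_to_lb | exists a]. Qed.

Lemma dist_to_eq0 x : A x -> dist_to x = 0.
Proof.
move=> Ax; apply/eqP; rewrite eq_le dist_to_ge0 ?andbT; last by exists x.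
by rewrite -(mdistxx x) dist_to_le.
Qed.

(* [d1bar] is the function on the quotient induced by [d1]. *)
Lemma d1bar_to_collapse x y :
  A !=set0 -> d1bar (to_collapse x) (to_collapse y) = d1 x y.
Proof.
move=> A0; rewrite /to_collapse; case: pselect => [nAx|/contrapT Ax];
  case: pselect => [nAy|/contrapT Ay] //=; rewrite /d1.
- by rewrite (dist_to_eq0 Ay) addr0 min_r// dist_to_le.
- by rewrite (dist_to_eq0 Ax) add0r metric_sym min_r// dist_to_le.
- by rewrite !dist_to_eq0// addr0 min_r// mdist_ge0.
Qed.

(* [K(X, A)], identified with the direct sum of copies of [int] indexed by
   [X \ A]; as a discrete group it carries the sigma-algebra of all subsets. *)
Definition KXA : Type := {freeg (~` A) / int}.
HB.instance Definition _ := GRing.Zmodule.on KXA.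
HB.instance Definition _ := isPointed.Build KXA 0.
HB.instance Definition _ := @isMeasurable.Build default_measure_display KXA
  discrete_measurable discrete_measurable0 discrete_measurableC
  discrete_measurableU.

Definition basis (x : ~` A) : KXA := << x >>.

End metric_pair.

(* Characters of the discrete group [G]: continuity is automatic, and
   [chi 0 = 1] follows from the two laws below. *)
Record dual (R : realType) (G : zmodType) := Dual {
  dual_fun :> G -> R[i];
  dualD : forall g h, dual_fun (g + h) = dual_fun g * dual_fun h;
  dual_norm : forall g, `|dual_fun g| = 1
}.

Section nu.
Context {R : realType} {X : metricType R} (A : set X) (psi : R -> R).

(* The pair [(x, y)] is determined by the value of [basis x - basis y], so the
   choice made here is immaterial; see [nu_basisB]. *)
Definition nu (kappa : KXA A) : R :=
  if pselect (exists xy : (~` A) * (~` A),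
      xy.1 <> xy.2 /\ kappa = basis xy.1 - basis xy.2) is left h then
    let xy := projT1 (cid h) in 2^-1 * psi (d1bar (Some xy.1) (Some xy.2))
  else 0.

Lemma basisB_inj (x y x' y' : ~` A) : x <> y ->
  basis x - basis y = basis x' - basis y' -> x = x' /\ y = y'.
Proof.
move=> /eqP xy e; have := congr1 (freeg.coeff y) e.
have := congr1 (freeg.coeff x) e.
have yx : (y == x) = false by rewrite eq_sym (negbTE xy).
rewrite /basis !coeffB !coeffU !mul1r !eqxx (negbTE xy) yx.
have [->|_] := eqVneq x' x; have [->|_] := eqVneq y' y => //.
- by rewrite (negbTE xy).
- by rewrite yx; case: eqP.
- by case: eqP; case: eqP.
Qed.

Lemma nu_basisB (x y : ~` A) : x <> y ->
  nu (basis x - basis y) = 2^-1 * psi (d1bar (Some x) (Some y)).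
Proof.
move=> xy; rewrite /nu; case: pselect => [h|]; last by case; exists (x, y).
by case: cid => -[x' y'] /= [_] /(basisB_inj xy)[<- <-].
Qed.

Lemma nu_eq0 (kappa : KXA A) :
  (forall x y : ~` A, x <> y -> kappa <> basis x - basis y) -> nu kappa = 0.
Proof.
move=> h; rewrite /nu; case: pselect => // hk; exfalso.
by have [[x y] /= [/h]] := hk.
Qed.

(* [fine] is harmless when [psi >= 0] has a finite sum over pairs, since then
   the sum below is finite. *)
Definition lambda (theta : dual R (KXA A)) : R :=
  fine (\esum_(kappa in [set kappa : KXA A | kappa != 0%R])
    (nu kappa * (1 - complex.Re (theta kappa)))%R%:E)%E.

End nu.

Section semigroup.
Context {R : realType} {X : metricType R} {A : set X}.
Implicit Type p q : probability (KXA A) R.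

(* The sum over the possibly uncountable group is the limit in [R[i]] of the
   net of finite partial sums. *)
Definition fourier p (theta : dual R (KXA A)) : R[i] :=
  @summability.sum (KXA A) R[i] R[i]^o
    (fun g => ((fine (p [set g]))%:C * (theta g)^*)%C).

Definition convolution p q (E : set (KXA A)) : \bar R :=
  (\int[p]_g q [set h | E (g + h)%R])%E.

Definition convolution_semigroup (p : {nonneg R} -> probability (KXA A) R) :=
  (forall E, p 0%:nng E = \d_(0 : KXA A) E) /\
  (forall (s t : {nonneg R}) E,
     p (s%:num + t%:num)%:nng E = convolution (p s) (p t) E).

End semigroup.

(* Main.v *)
(* The function nu is a symmetric finite measure on the discrete group K(X, A),
   and lambda(theta) = c - z(theta), where c is the total mass of nu and
   z(theta), real by symmetry, is its Fourier transform. The compound Poisson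
   masses p_t = exp(-tc) sum_n (t^n / n!) nu^{*n} therefore have Fourier
   transform exp(-tc) exp(t z(theta)) = exp(-t lambda(theta)).

   The Fourier transform is injective on nonnegative summable families:
   multiplying by (1 + Re chi(g - g0)) / 2, for a character chi equal to -1 at
   h - g0, keeps the value at g0, kills the value at h, does not increase the
   others, and preserves equality of Fourier transforms. Finitely many such
   factors isolate the point g0 up to an arbitrarily small mass. This gives
   uniqueness, and also the semigroup law, since p_s * p_t and p_{s+t} have the
   same transform. *)
Require Import Defs.
From HB Require Import structures.
From mathcomp Require Import all_boot all_order all_algebra.
From mathcomp Require Import finmap.
From mathcomp Require Import all_classical all_reals all_analysis.
From mathcomp.analysis.showcase Require summability.
From mathcomp.real_closed Require Import complex.
From mathcomp.multinomials Require Import freeg.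
From mathcomp Require Import measurable_realfun ring lra.

Set Implicit Arguments.
Unset Strict Implicit.
Unset Printing Implicit Defensive.

Import Order.TTheory GRing.Theory Num.Theory.
Import numFieldNormedType.Exports.

Local Open Scope classical_set_scope.
Local Open Scope ring_scope.

(** * Absolutely summable families *)

Section absolutely_summable.
Context {R : realType}.
Implicit Types T U : choiceType.

Definition asum T (f : T -> R) : Prop :=
  esum.summable [set: T] (EFin \o f).

(** Under [asum] both sums are finite and [fine] loses nothing; otherwise it may return its default
    value 0. *)
Definition rsum T (f : T -> R) : R :=
  fine (\esum_(i in [set: T]) (EFin \o f)^\+ i -
        \esum_(i in [set: T]) (EFin \o f)^\- i)%E.

Lemma asum_le T (f g : T -> R) :
  (forall i, `|f i| <= `|g i|) -> asum g -> asum f.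
Proof.
by move=> fg; apply: le_lt_trans; apply: le_esum => i _ /=; rewrite lee_fin.
Qed.

Lemma asum_ltP T (f : T -> R) : (forall i, 0 <= f i) ->
  (\esum_(i in [set: T]) (f i)%:E < +oo)%E <-> asum f.
Proof.
move=> f0; rewrite /asum /esum.summable.
by under [in X in _ <-> X]eq_esum do rewrite /= ger0_norm//.
Qed.

Lemma asumD T (f g : T -> R) :
  asum f -> asum g -> asum (fun i => f i + g i).
Proof. exact: summableD. Qed.

Lemma asumN T (f : T -> R) : asum f -> asum (fun i => - f i).
Proof. by apply: asum_le => i; rewrite normrN. Qed.

Lemma asumB T (f g : T -> R) :
  asum f -> asum g -> asum (fun i => f i - g i).
Proof. by move=> sf sg; apply/asumD/asumN. Qed.

(** Scaling by a nonnegative constant commutes with finite sums and with their supremum. *)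
Lemma esumZl T (S : set T) (c : R) (f : T -> R) : 0 <= c ->
  (forall i, 0 <= f i) ->
  (\esum_(i in S) (c * f i)%:E = c%:E * \esum_(i in S) (f i)%:E)%E.
Proof.
move=> c0 f0; rewrite /esum -ereal_supZl//; last first.
  apply/set0P; exists (\sum_(i \in set0) (f i)%:E)%E.
  by exists set0 => //; exact: fsets_set0.
congr ereal_sup; rewrite image_comp; apply: eq_imagel => F [finF _] /=.
by rewrite ge0_mule_fsumr// => i; rewrite lee_fin.
Qed.

Lemma asumZ T (c : R) (f : T -> R) : asum f -> asum (fun i => c * f i).
Proof.
rewrite /asum /esum.summable => sf.
under eq_esum do rewrite /= normrM.
by rewrite esumZl//; exact: lte_mul_pinfty.
Qed.

(** The positive and negative parts may be replaced by any two nonnegative summable families with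
    the same difference. Additivity of [rsum] on signed families rests on this freedom. *)
Lemma rsumBE T (u v : T -> R) : (forall i, 0 <= u i) -> (forall i, 0 <= v i) ->
  asum u -> asum v ->
  rsum (fun i => u i - v i) =
  fine (\esum_(i in [set: T]) (u i)%:E - \esum_(i in [set: T]) (v i)%:E)%E.
Proof.
move=> u0 v0 su sv; rewrite /rsum; congr fine.
by apply: (esumB su sv) => i _ /=; rewrite lee_fin.
Qed.

Lemma asum_fin_num T (f : T -> R) : (forall i, 0 <= f i) -> asum f ->
  (\esum_(i in [set: T]) (f i)%:E)%E \is a fin_num.
Proof.
move=> f0 /(asum_ltP f0) sf; rewrite ge0_fin_numE//.
by apply: esum_ge0 => i _; rewrite lee_fin.
Qed.

Lemma asum0 T : asum (fun _ : T => 0).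
Proof. by rewrite /asum /esum.summable esum1//= => i _; rewrite normr0. Qed.

Lemma rsumE T (f : T -> R) : (forall i, 0 <= f i) -> asum f ->
  (\esum_(i in [set: T]) (f i)%:E)%E = (rsum f)%:E.
Proof.
move=> f0 sf; have := @rsumBE _ f (fun=> 0) f0 (fun=> lexx _) sf (@asum0 T).
rewrite (_ : (fun i => f i - 0) = f); last by apply/funext => i; rewrite subr0.
by rewrite [X in (_ - X)%E]esum1// sube0 => ->; rewrite fineK// asum_fin_num.
Qed.

Lemma rsumB_nneg T (u v : T -> R) :
  (forall i, 0 <= u i) -> (forall i, 0 <= v i) ->
  asum u -> asum v ->
  rsum (fun i => u i - v i) = rsum u - rsum v.
Proof. by move=> u0 v0 su sv; rewrite rsumBE// !rsumE. Qed.

Lemma asum_decomp T (f : T -> R) : asum f -> exists u v : T -> R,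
  [/\ forall i, 0 <= u i, forall i, 0 <= v i, asum u, asum v &
      f = fun i => u i - v i].
Proof.
move=> sf; exists (fun i => Num.max (f i) 0), (fun i => Num.max (- f i) 0).
split.
- by move=> i; rewrite le_max lexx orbT.
- by move=> i; rewrite le_max lexx orbT.
- apply: asum_le sf => i; case: (leP (f i) 0) => // _.
  by rewrite normr0.
- apply: asum_le sf => i; case: (leP (- f i) 0) => _.
    by rewrite normr0.
  by rewrite normrN.
- apply/funext => i; case: (leP (f i) 0); case: (leP (- f i) 0); lra.
Qed.

Lemma rsumD_nneg T (u v : T -> R) :
  (forall i, 0 <= u i) -> (forall i, 0 <= v i) ->
  asum u -> asum v ->
  rsum (fun i => u i + v i) = rsum u + rsum v.
Proof.
move=> u0 v0 su sv; apply: EFin_inj; rewrite EFinD -!rsumE//.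
- by rewrite -esumD// => i _; rewrite lee_fin.
- by move=> i; rewrite addr_ge0.
- exact: asumD.
Qed.

Lemma rsumN T (f : T -> R) : asum f -> rsum (fun i => - f i) = - rsum f.
Proof.
move=> /asum_decomp[u [v [u0 v0 su sv ->]]].
by under eq_fun do rewrite opprB; rewrite !rsumB_nneg// opprB.
Qed.

Lemma rsumD T (f g : T -> R) : asum f -> asum g ->
  rsum (fun i => f i + g i) = rsum f + rsum g.
Proof.
move=> /asum_decomp[u [v [u0 v0 su sv ->]]].
move=> /asum_decomp[u' [v' [u'0 v'0 su' sv' ->]]].
rewrite (_ : (fun _ => _) = fun i => (u i + u' i) - (v i + v' i)); last first.
  by apply/funext => i; rewrite opprD addrACA.
rewrite !rsumB_nneg//; last 4 first.
- by move=> i; rewrite addr_ge0.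
- by move=> i; rewrite addr_ge0.
- exact: asumD.
- exact: asumD.
by rewrite (rsumD_nneg u0 u'0)// (rsumD_nneg v0 v'0)// opprD addrACA.
Qed.

Lemma rsumB T (f g : T -> R) : asum f -> asum g ->
  rsum (fun i => f i - g i) = rsum f - rsum g.
Proof. by move=> sf sg; rewrite rsumD ?rsumN//; exact: asumN. Qed.

Lemma rsumZ T (c : R) (f : T -> R) : asum f ->
  rsum (fun i => c * f i) = c * rsum f.
Proof.
(* Nonnegative factors come first, on nonnegative families and then on signed ones by decomposition;
   a negative factor is reduced to them by [rsumN]. *)
have nneg (k : R) (g : T -> R) : 0 <= k -> (forall i, 0 <= g i) -> asum g ->
    rsum (fun i => k * g i) = k * rsum g.
  move=> k0 g0 sg; apply: EFin_inj; rewrite EFinM -!rsumE//.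
  - by rewrite esumZl.
  - by move=> i; rewrite mulr_ge0.
  - exact: asumZ.
have pos (k : R) (g : T -> R) : 0 <= k -> asum g ->
    rsum (fun i => k * g i) = k * rsum g.
  move=> k0 /asum_decomp[u [v [u0 v0 su sv ->]]].
  under eq_fun do rewrite mulrBr.
  by rewrite !rsumB ?nneg ?mulrBr//; exact: asumZ.
move=> sf; have [c0|c0] := leP 0 c; first exact: pos.
rewrite -[in LHS](opprK c); under eq_fun do rewrite mulNr.
rewrite rsumN; last exact: asumZ.
by rewrite pos ?oppr_ge0 1?ltW// mulNr opprK.
Qed.

Lemma rsum_ge0 T (f : T -> R) : (forall i, 0 <= f i) -> asum f -> 0 <= rsum f.
Proof.
move=> f0 sf; rewrite -lee_fin -rsumE//; apply: esum_ge0 => i _.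
by rewrite lee_fin.
Qed.

Lemma ler_rsum T (f g : T -> R) : asum f -> asum g ->
  (forall i, f i <= g i) -> rsum f <= rsum g.
Proof.
move=> sf sg fg; rewrite -subr_ge0 -rsumB//; apply: rsum_ge0 => [i|].
  by rewrite subr_ge0.
exact: asumB.
Qed.

Lemma esum_single T (x : T) (g : T -> \bar R) : (forall i, 0 <= g i)%E ->
  (forall i, i != x -> g i = 0)%E -> (\esum_(i in [set: T]) g i = g x)%E.
Proof.
move=> g0 gx; rewrite (esumID [set x])// setTI esum_set1// esum1 ?adde0//.
by move=> i [_ /eqP/gx].
Qed.

Lemma rsum_single T (x : T) (f : T -> R) : (forall i, i != x -> f i = 0) ->
  asum f /\ rsum f = f x.
Proof.
move=> fx; split.
  rewrite /asum /esum.summable (@esum_single _ x)//=; first by rewrite ltry.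
  by move=> i /fx ->; rewrite normr0.
rewrite /rsum !(@esum_single _ x)//=.
- rewrite !funeposE !funenegE/= -!EFin_max/=.
  by case: (leP (f x) 0); case: (leP (- f x) 0); lra.
- by move=> i /fx ix; rewrite funenegE /= ix oppr0 maxxx.
- by move=> i /fx ix; rewrite funeposE /= ix maxxx.
Qed.

Lemma reindex_asum T U (e : T -> U) (f : U -> R) : bijective e ->
  asum f -> asum (f \o e).
Proof.
rewrite -setTT_bijective /asum /esum.summable => be.
by rewrite (reindex_esum [set: T] [set: U] e _ be).
Qed.

Lemma reindex_rsum T U (e : T -> U) (f : U -> R) : bijective e ->
  rsum f = rsum (f \o e).
Proof.
rewrite -setTT_bijective /rsum => be.
rewrite !(reindex_esum [set: T] [set: U] e _ be).
by congr (fine (_ - _)); apply: eq_esum => i _; rewrite !(funeposE, funenegE).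
Qed.

Lemma swap_bij (T U : Type) : bijective (fun z : T * U => (z.2, z.1)).
Proof. by exists (fun z => (z.2, z.1)) => -[]. Qed.

Lemma esum_pair T U (f : T -> U -> \bar R) : (forall x y, 0 <= f x y)%E ->
  (\esum_(x in [set: T]) \esum_(y in [set: U]) f x y =
   \esum_(z in [set: T * U]) f z.1 z.2)%E.
Proof.
move=> f0; rewrite esum_esum//; congr esum.
by apply/seteqP; split=> -[].
Qed.

Lemma esum_swap T U (f : T -> U -> \bar R) : (forall x y, 0 <= f x y)%E ->
  (\esum_(x in [set: T]) \esum_(y in [set: U]) f x y =
   \esum_(y in [set: U]) \esum_(x in [set: T]) f x y)%E.
Proof.
move=> f0; rewrite !esum_pair//.
rewrite (reindex_esum [set: U * T] [set: T * U] (fun z => (z.2, z.1)))//.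
by rewrite setTT_bijective; exact: swap_bij.
Qed.

(** Tonelli's criterion: the double sum of absolute values is the iterated one. *)
Lemma asum_pair T U (f : T -> U -> R) :
  (forall x, asum (f x)) -> asum (fun x => rsum (fun y => `|f x y|)) ->
  asum (fun z : T * U => f z.1 z.2).
Proof.
move=> sf sF; rewrite /asum /esum.summable/=.
rewrite -(@esum_pair _ _ (fun x y => `|f x y|%:E))//.
have sf' x : asum (fun y => `|f x y|).
  by apply: asum_le (sf x) => y; rewrite normr_id.
under eq_esum do rewrite rsumE//.
apply/asum_ltP => // x; exact: rsum_ge0.
Qed.

(** The section over [x] contributes one term to the iterated sum of absolute values, hence is
    bounded by the total. *)
Lemma asum_sectionl T U (f : T * U -> R) (x : T) :
  asum f -> asum (fun y => f (x, y)).
Proof.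
rewrite /asum /esum.summable.
have -> : (\esum_(z in [set: T * U]) `|(EFin \o f) z| =
    \esum_(x' in [set: T]) \esum_(y in [set: U]) `|f (x', y)|%:E)%E.
  by rewrite esum_pair//; apply: eq_esum => -[].
have e0 x' : (0 <= \esum_(y in [set: U]) `|f (x', y)|%:E)%E.
  by apply: esum_ge0 => y _; rewrite lee_fin.
apply: le_lt_trans; rewrite [leRHS](esumID [set x])//.
by rewrite setTI esum_set1// leeDl// esum_ge0.
Qed.

Lemma rsum_pair_nneg T U (f : T * U -> R) : (forall z, 0 <= f z) -> asum f ->
  asum (fun x => rsum (fun y => f (x, y))) /\
  rsum f = rsum (fun x => rsum (fun y => f (x, y))).
Proof.
move=> f0 sf.
have fx0 x : 0 <= rsum (fun y => f (x, y)).
  by apply: rsum_ge0 => //; exact: asum_sectionl.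
have e : (\esum_(z in [set: T * U]) (f z)%:E =
    \esum_(x in [set: T]) (rsum (fun y => f (x, y)))%:E)%E.
  under [RHS]eq_esum => x _.
    rewrite -rsumE//; last exact: asum_sectionl.
    over.
  rewrite (@esum_pair _ _ (fun x y => (f (x, y))%:E)) => [|x y].
    by apply: eq_esum => -[].
  by rewrite lee_fin.
have sF : asum (fun x => rsum (fun y => f (x, y))).
  by apply/(asum_ltP fx0); rewrite -e rsumE// ltry.
by split=> //; apply: EFin_inj; rewrite -!rsumE.
Qed.

(** Fubini for signed families, from the nonnegative case applied to the two terms of a
    decomposition. *)
Lemma rsum_pair T U (f : T * U -> R) : asum f ->
  asum (fun x => rsum (fun y => f (x, y))) /\
  rsum f = rsum (fun x => rsum (fun y => f (x, y))).
Proof.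
move=> /asum_decomp[u [v [u0 v0 su sv ->]]].
have [su' eu] := rsum_pair_nneg u0 su; have [sv' ev] := rsum_pair_nneg v0 sv.
have e : (fun x => rsum (fun y => u (x, y) - v (x, y))) =
    (fun x => rsum (fun y => u (x, y)) - rsum (fun y => v (x, y))).
  by apply/funext => x; rewrite rsumB//; exact: asum_sectionl.
rewrite e; split; first exact: asumB.
by rewrite !rsumB// eu ev.
Qed.

Lemma rsum_swap T U (f : T * U -> R) : asum f ->
  rsum (fun x => rsum (fun y => f (x, y))) =
  rsum (fun y => rsum (fun x => f (x, y))).
Proof.
move=> sf; have [_ <-] := rsum_pair sf.
have [_ /=] := rsum_pair (reindex_asum (swap_bij U T) sf).
by rewrite (reindex_rsum _ (swap_bij U T)) => ->.
Qed.

End absolutely_summable.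

(* Complex families and limits along the net of finite subsets *)
#[local] Existing Instance summability.totally_filter.

Section complex_sums.
Context {R : realType}.
Implicit Types T U : choiceType.
Local Notation Re := complex.Re.
Local Notation Im := complex.Im.

Lemma sum_le_rsum T (f : T -> R) (F : {fset T}) :
  (forall i, 0 <= f i) -> asum f -> \sum_(i <- F) f i <= rsum f.
Proof.
move=> f0 sf; rewrite -lee_fin -rsumE//; apply: esum_ge.
exists [set` F] => //; rewrite fsbig_finite//= set_fsetK.
by rewrite sumEFin.
Qed.

Lemma rsum_approx T (f : T -> R) (e : R) : 0 < e ->
  (forall i, 0 <= f i) -> asum f ->
  exists F : {fset T}, rsum f - e < \sum_(i <- F) f i.
Proof.
move=> e0 f0 sf.
have : ((rsum f - e)%:E < \esum_(i in [set: T]) (f i)%:E)%E.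
  by rewrite rsumE// lte_fin ltrBlDr ltrDl.
move=> /ereal_sup_gt[_ [S [finS _] <-]].
by rewrite fsbig_finite// sumEFin lte_fin => ?; exists (fset_set S).
Qed.

Lemma rsum_fset T (f : T -> R) (F : {fset T}) : (forall i, 0 <= f i) ->
  asum (fun i => if i \in F then f i else 0) /\
  rsum (fun i => if i \in F then f i else 0) = \sum_(i <- F) f i.
Proof.
move=> f0; set g := fun i => _.
have g0 i : 0 <= g i by rewrite /g; case: ifP.
have e : (\esum_(i in [set: T]) (g i)%:E = (\sum_(i <- F) f i)%:E)%E.
  transitivity (\esum_(i in [set` F]) (f i)%:E)%E.
    rewrite [RHS]esum_mkcond; apply: eq_esum => i _.
    by rewrite /g mem_setE; case: ifP.
  rewrite esum_fset//.
    by rewrite fsbig_finite//= set_fsetK sumEFin.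
  by move=> i _; rewrite lee_fin.
have sg : asum g by apply/(asum_ltP g0); rewrite e ltry.
by split=> //; apply: EFin_inj; rewrite -rsumE.
Qed.

(** For a nonnegative family, once a finite set reaches the total up to [e], every larger finite set
    has its partial sum between that value and the total. A signed family is a difference of two
    such families. *)
Lemma partial_sum_cvg T (f : T -> R) : asum f ->
  summability.partial_sum f @ summability.totally --> rsum f.
Proof.
have psE (g : T -> R) (F : {fset T}) :
    summability.partial_sum g F = \sum_(i <- F) g i.
  by rewrite /summability.partial_sum big_seq_fsetE.
have nneg (u : T -> R) : (forall i, 0 <= u i) -> asum u ->
    summability.partial_sum u @ summability.totally --> rsum u.
  move=> u0 su; apply/cvgrPdist_lt => e e0.
  have [F FP] := rsum_approx e0 u0 su.
  exists F => // G /= FG.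
  rewrite psE ger0_norm ?subr_ge0 ?sum_le_rsum// ltrBlDl -ltrBlDr.
  apply: (lt_le_trans FP); rewrite [leRHS](big_fsetID _ (mem F))/=.
  rewrite (_ : [fset x | x in G & x \in F]%fset = F).
    by rewrite lerDl sumr_ge0.
  apply/fsetP => x; rewrite !inE/= andbC; case: (boolP (x \in F)) => //= xF.
  by rewrite (fsubsetP FG).
move=> /asum_decomp[u [v [u0 v0 su sv ->]]]; rewrite rsumB//.
rewrite (_ : summability.partial_sum _ =
    summability.partial_sum u \- summability.partial_sum v).
  by apply: cvgB; exact: nneg.
by apply/funext => F; rewrite /= !psE sumrB.
Qed.

Definition casum T (f : T -> R[i]) : Prop :=
  asum (fun i => Re (f i)) /\ asum (fun i => Im (f i)).

Definition csum T (f : T -> R[i]) : R[i] :=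
  Complex (rsum (fun i => Re (f i))) (rsum (fun i => Im (f i))).

Lemma ReD (x y : R[i]) : Re (x + y) = Re x + Re y.
Proof. by case: x; case: y. Qed.

Lemma ImD (x y : R[i]) : Im (x + y) = Im x + Im y.
Proof. by case: x; case: y. Qed.

Lemma ReM (x y : R[i]) : Re (x * y) = Re x * Re y - Im x * Im y.
Proof. by case: x; case: y. Qed.

Lemma ImM (x y : R[i]) : Im (x * y) = Re x * Im y + Im x * Re y.
Proof. by case: x; case: y. Qed.

(** Multiplication by the imaginary unit preserves the norm and reduces the claim to the bound on
    real parts. *)
Lemma normc_ge_Im (x : R[i]) : (`|Im x|%:C <= `|x|)%C.
Proof.
have := normc_ge_Re (x * 'i%C); rewrite ReiNIm normrN normrM.
by rewrite (normc_def 'i%C)/= expr0n expr1n add0r sqrtr1 mulr1.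
Qed.

Lemma normc_le_ReIm (x : R[i]) : (`|x| <= (`|Re x| + `|Im x|)%:C)%C.
Proof.
rewrite {1}(complexE x); apply: (le_trans (ler_normD _ _)).
rewrite normrM (normc_def 'i%C)/= expr0n expr1n add0r sqrtr1 mul1r.
rewrite !normc_def/= !expr0n /= !addr0 !sqrtr_sqr.
by rewrite -rmorphD.
Qed.

Lemma csum_lim T (f : T -> R[i]) : casum f ->
  @summability.sum T R[i] R[i]^o f = csum f.
Proof.
move=> [sr si]; apply: (cvg_lim (@norm_hausdorff R[i] R[i]^o)).
have /cvgrPdist_lt cr := partial_sum_cvg sr.
have /cvgrPdist_lt ci := partial_sum_cvg si.
(* A positive element of [R[i]] has zero imaginary part, so [e] is real and half of it is allotted
   to each coordinate. *)
apply/cvgrPdist_lt => e; rewrite ltcE/= => /andP[/eqP ie0 re0].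
have e2 : 0 < Re e / 2 by rewrite divr_gt0.
apply: filterS (filterI (cr _ e2) (ci _ e2)) => F [].
have -> : summability.partial_sum (fun i => Re (f i)) F =
    Re (summability.partial_sum f F).
  by rewrite /summability.partial_sum (big_morph _ ReD (erefl : Re 0 = 0)).
have -> : summability.partial_sum (fun i => Im (f i)) F =
    Im (summability.partial_sum f F).
  by rewrite /summability.partial_sum (big_morph _ ImD (erefl : Im 0 = 0)).
case: (summability.partial_sum f F) => a b /= ha hb.
apply: (le_lt_trans (normc_le_ReIm _)).
by rewrite ltcE/= -ie0 eqxx/=; lra.
Qed.

Lemma csumD T (f g : T -> R[i]) : casum f -> casum g ->
  csum (fun i => f i + g i) = csum f + csum g.
Proof.
move=> [? ?] [? ?]; rewrite /csum.
under eq_fun do rewrite ReD.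
under [X in Complex _ (rsum X)]eq_fun do rewrite ImD.
by rewrite !rsumD.
Qed.

Lemma casumD T (f g : T -> R[i]) : casum f -> casum g ->
  casum (fun i => f i + g i).
Proof.
move=> [? ?] [? ?]; split.
  by under eq_fun do rewrite ReD; exact: asumD.
by under eq_fun do rewrite ImD; exact: asumD.
Qed.

Lemma casumZ T (c : R[i]) (f : T -> R[i]) : casum f -> casum (fun i => c * f i).
Proof.
move=> [? ?]; split.
  by under eq_fun do rewrite ReM; apply: asumB; exact: asumZ.
by under eq_fun do rewrite ImM; apply: asumD; exact: asumZ.
Qed.

Lemma csumZ T (c : R[i]) (f : T -> R[i]) : casum f ->
  csum (fun i => c * f i) = c * csum f.
Proof.
move=> [sr si]; rewrite /csum.
under eq_fun do rewrite ReM.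
under [X in Complex _ (rsum X)]eq_fun do rewrite ImM.
rewrite rsumB ?rsumD ?rsumZ//; try exact: asumZ.
by apply/eqP; rewrite eq_complex ReM ImM/= !eqxx.
Qed.

Lemma csum_real T (w : T -> R) : csum (fun i => (w i)%:C%C) = (rsum w)%:C%C.
Proof.
rewrite /csum/=; congr Complex.
(* Evaluating the zero family by [rsum_single] requires an index, so an empty [T] is treated
   apart. *)
case: (pselect (T -> False)) => [T0|/existsNP[x _]].
  by rewrite /rsum !esum1 ?sube0// => i; case: (T0 i).
by have [_ ->] := @rsum_single R T x (fun=> 0) (fun _ _ => erefl).
Qed.

Lemma casum_real T (w : T -> R) : asum w -> casum (fun i => (w i)%:C%C).
Proof. by move=> sw; split=> //; apply: asum_le sw => i /=; rewrite normr0. Qed.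

Lemma casumM T (w : T -> R) (u : T -> R[i]) : asum w ->
  (forall i, `|u i| <= 1) -> casum (fun i => (w i)%:C%C * u i).
Proof.
move=> sw u1; split; apply: asum_le sw => i.
  rewrite -lecR; apply: (le_trans (normc_ge_Re _)).
  rewrite normrM (normc_def (w i)%:C%C)/= expr0n/= addr0 sqrtr_sqr.
  by rewrite ler_piMr// ler0c.
rewrite -lecR; apply: (le_trans (normc_ge_Im _)).
rewrite normrM (normc_def (w i)%:C%C)/= expr0n/= addr0 sqrtr_sqr.
by rewrite ler_piMr// ler0c.
Qed.

Lemma reindex_casum T U (e : T -> U) (f : U -> R[i]) : bijective e ->
  casum f -> casum (f \o e).
Proof.
by move=> be [sr si]; split; [exact: (reindex_asum be sr)|
  exact: (reindex_asum be si)].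
Qed.

Lemma reindex_csum T U (e : T -> U) (f : U -> R[i]) : bijective e ->
  csum f = csum (f \o e).
Proof. by move=> be; rewrite /csum !(reindex_rsum _ be). Qed.

Lemma csum_pair T U (f : T * U -> R[i]) : casum f ->
  csum f = csum (fun x => csum (fun y => f (x, y))).
Proof. by move=> [/rsum_pair[_ er] /rsum_pair[_ ei]]; rewrite /csum er ei. Qed.

Lemma casum_pair T U (f : T * U -> R[i]) : casum f ->
  casum (fun x => csum (fun y => f (x, y))).
Proof. by move=> [/rsum_pair[sr _] /rsum_pair[si _]]. Qed.

Lemma csum_swap T U (f : T * U -> R[i]) : casum f ->
  csum (fun x => csum (fun y => f (x, y))) =
  csum (fun y => csum (fun x => f (x, y))).
Proof. by move=> [sr si]; rewrite /csum/= (rsum_swap sr) (rsum_swap si). Qed.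

Lemma asum_mul T U (f : T -> R) (g : U -> R) : asum f -> asum g ->
  asum (fun z : T * U => f z.1 * g z.2).
Proof.
move=> sf sg; apply: (@asum_pair _ _ _ (fun x y => f x * g y)) => [x|].
  exact: asumZ.
have sg' : asum (fun y => `|g y|) by apply: asum_le sg => y; rewrite normr_id.
have -> : (fun x => rsum (fun y => `|f x * g y|)) =
    (fun x => rsum (fun y => `|g y|) * `|f x|).
  apply/funext => x; under eq_fun do rewrite normrM.
  by rewrite rsumZ// mulrC.
by apply: asumZ; apply: asum_le sf => x; rewrite normr_id.
Qed.

Lemma casum_mul T U (f : T -> R[i]) (g : U -> R[i]) : casum f -> casum g ->
  casum (fun z : T * U => f z.1 * g z.2).
Proof.
move=> [fr fi] [gr gi]; split.
  under eq_fun do rewrite ReM.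
  exact: asumB (asum_mul fr gr) (asum_mul fi gi).
under eq_fun do rewrite ImM.
exact: asumD (asum_mul fr gi) (asum_mul fi gr).
Qed.

Lemma csum_mul T U (f : T -> R[i]) (g : U -> R[i]) : casum f -> casum g ->
  csum (fun z : T * U => f z.1 * g z.2) = csum f * csum g.
Proof.
move=> sf sg; rewrite csum_pair/=; last exact: casum_mul.
under eq_fun => x do rewrite csumZ// mulrC.
by rewrite csumZ// mulrC.
Qed.

End complex_sums.

(** * Fourier transform on a discrete abelian group *)

Section characters.
Context {R : realType} {G : zmodType}.
Implicit Types (theta chi : dual R G) (a b : G -> R).
Local Notation Re := complex.Re.

Lemma conjcM (x y : R[i]) : ((x * y)^*)%C = x^*%C * y^*%C.
Proof. exact: rmorphM. Qed.

Lemma conjcJ (x : R[i]) : (x^*%C)^*%C = x.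
Proof. exact: conjcK. Qed.

Lemma dual_normJ theta g : `|(theta g)^*%C| <= 1.
Proof. by rewrite normcJ dual_norm. Qed.

Lemma dual1_subproof :
  (forall g h : G, (1 : R[i]) = 1 * 1) /\ (forall g : G, `|1 : R[i]| = 1).
Proof. by split=> [_ _|_]; rewrite ?mulr1 ?normr1. Qed.

(** The trivial character; evaluating a transform there gives the total mass. *)
Definition dual1 : dual R G :=
  @Dual R G (fun=> 1) dual1_subproof.1 dual1_subproof.2.

Lemma dual1J g : (dual1 g)^*%C = 1.
Proof. exact: conjc1. Qed.

Lemma dualM_subproof theta chi :
  (forall g h, theta (g + h) * chi (g + h) =
    (theta g * chi g) * (theta h * chi h)) /\
  (forall g, `|theta g * chi g| = 1).
Proof.
by split=> [g h|g]; [rewrite !dualD mulrACA|rewrite normrM !dual_norm mulr1].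
Qed.

Definition dualM theta chi : dual R G :=
  @Dual R G (fun g => theta g * chi g)
    (dualM_subproof theta chi).1 (dualM_subproof theta chi).2.

Lemma dualJ_subproof theta :
  (forall g h, (theta (g + h))^*%C = (theta g)^*%C * (theta h)^*%C) /\
  (forall g, `|(theta g)^*%C| = 1).
Proof. by split=> [g h|g]; [rewrite dualD conjcM|rewrite normcJ dual_norm]. Qed.

Definition dualJ theta : dual R G :=
  @Dual R G (fun g => (theta g)^*%C)
    (dualJ_subproof theta).1 (dualJ_subproof theta).2.

Lemma dualME theta chi g : dualM theta chi g = theta g * chi g.
Proof. by []. Qed.

Lemma dualJE theta g : dualJ theta g = (theta g)^*%C.
Proof. by []. Qed.

(** The value at 0 is idempotent, and it is nonzero because its norm is 1. *)
Lemma dual0 theta : theta 0 = 1.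
Proof.
have := dualD theta 0 0; rewrite addr0 => /esym/eqP.
rewrite -[X in _ == X]mulr1 -subr_eq0 -mulrBr mulf_eq0 subr_eq0.
case/orP=> /eqP// t0; have := dual_norm theta 0.
by rewrite t0 normr0 => /esym/eqP; rewrite oner_eq0.
Qed.

(** Both sides are inverse to [theta g], the conjugate because [theta g] has norm 1. *)
Lemma dualN theta g : theta (- g) = (theta g)^*%C.
Proof.
have tg : theta g != 0.
  by rewrite -normr_eq0 dual_norm oner_neq0.
apply: (mulfI tg); rewrite -dualD subrr dual0 -sqr_normc dual_norm.
by rewrite expr1n.
Qed.

Lemma dual_Re_bound theta g : `|Re (theta g)| <= 1.
Proof. by rewrite -lecR (le_trans (normc_ge_Re _))// dual_norm. Qed.

Definition ft a theta : R[i] := csum (fun g => (a g)%:C%C * (theta g)^*%C).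

Lemma casum_ft a theta : asum a ->
  casum (fun g => (a g)%:C%C * (theta g)^*%C).
Proof. by move=> sa; apply: casumM => // g; exact: dual_normJ. Qed.

Lemma ft_dual1 a : ft a dual1 = (rsum a)%:C%C.
Proof.
by rewrite /ft; under eq_fun do rewrite dual1J mulr1; exact: csum_real.
Qed.

(* The averaging factor [(1 + Re (chi (g - g0))) / 2] is a combination of
   characters, takes values in [0, 1], is [1] at [g0] and vanishes wherever
   [chi (g - g0) = -1]. *)
Lemma ft_cutoff a chi g0 theta : asum a ->
  ft (fun g => a g * ((1 + Re (chi (g - g0))) / 2)) theta =
  2^-1 * ft a theta +
  (4^-1 * chi (- g0) * ft a (dualM theta (dualJ chi)) +
   4^-1 * (chi (- g0))^*%C * ft a (dualM theta chi)).
Proof.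
move=> sa.
pose F (t : dual R G) := fun g => (a g)%:C%C * (t g)^*%C : R[i].
have s t c : casum (fun g => c * F t g) := casumZ c (casum_ft t sa).
have z t c : c * ft a t = csum (fun g => c * F t g) :=
  esym (csumZ c (casum_ft t sa)).
rewrite !z -(csumD (s _ _) (s _ _)).
rewrite -(csumD (s _ _) (casumD (s _ _) (s _ _))).
congr csum; apply/funext => g; rewrite /F !dualME dualJE !conjcM conjcJ.
have -> : (a g * ((1 + Re (chi (g - g0))) / 2))%:C%C =
  (a g)%:C%C * (2^-1 + 4^-1 * (chi (g - g0) + (chi (g - g0))^*%C)) :> R[i].
  rewrite addcJ !rmorphM rmorphD rmorph1 fmorphV rmorph_nat; congr (_ * _).
  by field.
rewrite dualD conjcM; ring.
Qed.

(** The exact value -1 is what makes an averaging factor vanish at a prescribed point. This is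
    stronger than separation of points: an element of order 3 admits no such character. *)
Definition separating_dual := forall g : G, g != 0 ->
  exists chi : dual R G, chi g = -1.

(** The multiplier [m] is a product of averaging factors, one for each entry of [F] other than [g0].
    By [ft_cutoff] each new transform is a combination, with coefficients independent of the family,
    of values of the previous one, so equality persists. *)
Lemma cutoff_exists a b (F : seq G) g0 : separating_dual ->
  (forall g, 0 <= a g) -> (forall g, 0 <= b g) -> asum a -> asum b ->
  ft a =1 ft b ->
  exists m : G -> R, [/\ forall g, 0 <= m g <= 1, m g0 = 1,
    forall g, g \in F -> g != g0 -> m g = 0 &
    ft (fun g => a g * m g) =1 ft (fun g => b g * m g)].
Proof.
move=> sepG a0 b0 sa sb ab; elim: F => [|x F [m [m01 mg0 mF abm]]].
  exists (fun=> 1); split=> //; first by move=> g; rewrite ler01 lexx.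
  move=> theta; under eq_fun do rewrite mulr1.
  by under [in RHS]eq_fun do rewrite mulr1.
have [->|xg0] := eqVneq x g0.
  exists m; split=> // g; rewrite inE => /orP[/eqP ->|]; first by rewrite eqxx.
  exact: mF.
have [|chi chix] := sepG (x - g0); first by rewrite subr_eq0.
have bnd g : 0 <= (1 + Re (chi (g - g0))) / 2 <= 1.
  by have := dual_Re_bound chi (g - g0); rewrite ler_norml; lra.
have sm (c : G -> R) : asum c -> asum (fun g => c g * m g).
  apply: asum_le => g; rewrite normrM ler_piMr//.
  by have /andP[? ?] := m01 g; rewrite ger0_norm.
exists (fun g => m g * ((1 + Re (chi (g - g0))) / 2)); split.
- move=> g; have /andP[? ?] := m01 g; have /andP[? ?] := bnd g.
  by rewrite mulr_ge0//= mulr_ile1.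
- by rewrite mg0 subrr dual0/=; lra.
- move=> g; rewrite inE => /orP[/eqP ->|gF gg0]; last by rewrite mF// mul0r.
  by rewrite chix/= addrN mul0r mulr0.
- move=> theta.
  under eq_fun do rewrite mulrA; under [in RHS]eq_fun do rewrite mulrA.
  by rewrite !ft_cutoff ?abm//; exact: sm.
Qed.

Lemma ft_inj a b : separating_dual ->
  (forall g, 0 <= a g) -> (forall g, 0 <= b g) -> asum a -> asum b ->
  ft a =1 ft b -> a = b.
Proof.
move=> sepG.
(* The hypotheses are symmetric in the two families, so a pointwise inequality suffices. *)
suff le (a' b' : G -> R) g0 : (forall g, 0 <= a' g) -> (forall g, 0 <= b' g) ->
    asum a' -> asum b' -> ft a' =1 ft b' -> a' g0 <= b' g0.
  move=> a0 b0 sa sb ab; apply/funext => g; apply/eqP; rewrite eq_le.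
  by rewrite !le// => theta; rewrite ab.
move=> {a b} a0 b0 sa sb ab; apply/ler_addgt0Pr => e e0.
(* Outside [F] the family [b'] has mass less than [e]. *)
have [F FP] := rsum_approx e0 b0 sb.
have [m [m01 mg0 mF /(_ dual1)]] := cutoff_exists F g0 sepG a0 b0 sa sb ab.
have sm (c : G -> R) : asum c -> asum (fun g => c g * m g).
  apply: asum_le => g; rewrite normrM ler_piMr//.
  by have /andP[? ?] := m01 g; rewrite ger0_norm.
(* The trivial character turns equality of the cut-off transforms into equality of total masses. *)
rewrite !ft_dual1 => /complexI abm.
have m0 g : 0 <= m g by have /andP[] := m01 g.
have m1 g : m g <= 1 by have /andP[] := m01 g.
have le_am : a' g0 <= rsum (fun g => a' g * m g).
  have := @sum_le_rsum _ _ _ [fset g0]%fset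
    (fun g => mulr_ge0 (a0 g) (m0 g)) (sm _ sa).
  by rewrite big_seq_fset1 mg0 mulr1.
apply: (le_trans le_am); rewrite abm.
pose d g := if g == g0 then b' g else 0.
have [|sd] := @rsum_single R _ g0 d.
  by move=> g /negbTE; rewrite /d => ->.
rewrite {2}/d eqxx => ed.
have [sF eF] := rsum_fset F b0.
(* After the cutoff, [b'] is dominated by its value at [g0] plus its restriction to the complement
   of [F]. *)
apply: (@le_trans _ _ (rsum (fun g => d g +
    (b' g - (if g \in F then b' g else 0))))).
  apply: ler_rsum => [||g]; first exact: sm.
    by apply: asumD => //; exact: asumB.
  rewrite /d; case: ifPn => [_|gg0]; case: ifPn => gF.
  - by rewrite subrr addr0 ler_piMr.
  - by rewrite subr0 (le_trans (ler_piMr _ _))// lerDl.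
  - by rewrite subrr addr0 mF// mulr0.
  - by rewrite add0r subr0 ler_piMr.
rewrite rsumD ?rsumB// ?ed ?eF; last exact: asumB.
by lra.
Qed.

Definition convol a b : G -> R := fun k => rsum (fun h => a h * b (k - h)).

(** The shear taking [(k, h)] to [(h, k - h)] turns the terms of a convolution into a product
    family, to which the product rules for sums apply. *)
Lemma convol_bij : bijective (fun z : G * G => (z.2, z.1 - z.2)).
Proof.
exists (fun z => (z.2 + z.1, z.1)) => -[x y] /=; first by rewrite subrK.
by rewrite addrK.
Qed.

Lemma asum_convol_pair a b : asum a -> asum b ->
  asum (fun z : G * G => a z.2 * b (z.1 - z.2)).
Proof. by move=> sa sb; exact: (reindex_asum convol_bij (asum_mul sa sb)). Qed.

Lemma asum_convol a b : asum a -> asum b -> asum (convol a b).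
Proof. by move=> sa sb; have [] := rsum_pair (asum_convol_pair sa sb). Qed.

Lemma convol_ge0 a b : (forall g, 0 <= a g) -> (forall g, 0 <= b g) ->
  asum a -> asum b -> forall g, 0 <= convol a b g.
Proof.
move=> a0 b0 sa sb g; apply: rsum_ge0 => [h|]; first by rewrite mulr_ge0.
exact: (asum_sectionl g (asum_convol_pair sa sb)).
Qed.

Lemma ft_convol a b theta : asum a -> asum b ->
  ft (convol a b) theta = ft a theta * ft b theta.
Proof.
move=> sa sb; rewrite /ft -csum_mul; [|exact: casum_ft..].
have sab := casum_mul (casum_ft theta sa) (casum_ft theta sb).
rewrite (reindex_csum _ convol_bij).
rewrite (csum_pair (reindex_casum convol_bij sab))/=.
congr csum; apply/funext => k; rewrite -csum_real mulrC -csumZ; last first.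
  exact: casum_real (asum_sectionl k (asum_convol_pair sa sb)).
congr csum; apply/funext => h /=.
have -> : theta k = theta h * theta (k - h) by rewrite -dualD addrC subrK.
by rewrite conjcM rmorphM/= [LHS]mulrC mulrACA.
Qed.

End characters.

(** * Compound Poisson masses *)

Section exponential_series.
Context {R : realType}.

(** Links unordered sums over [nat] with limits of successive partial sums, through which [expR] is
    defined. *)
Lemma rsum_series (f : nat -> R) : asum f -> series f @ \oo --> rsum f.
Proof.
have nneg (u : nat -> R) : (forall i, 0 <= u i) -> asum u ->
    series u @ \oo --> rsum u.
  move=> u0 su.
  have su' : esum.summable xpredT (EFin \o u).
    by have -> : xpredT = [set: nat] :> set nat by apply/seteqP; split.
  have u0' n : xpredT n -> (0 <= (EFin \o u) n)%E by rewrite lee_fin.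
  have := summable_nneseries_lim u0' su'.
  rewrite nneseries_esumT/= => [|n]; last by rewrite lee_fin.
  rewrite rsumE// => -[->]; exact: (summable_cvg u0' su').
move=> /asum_decomp[u [v [u0 v0 su sv ->]]].
rewrite rsumB// (_ : series _ = series u \- series v).
  by apply: cvgB; exact: nneg.
by apply/funext => n; rewrite /series/= sumrB.
Qed.

Lemma asum_exp_coeff (x : R) : asum (exp_coeff x).
Proof.
apply: (@asum_le _ _ _ (exp_coeff `|x|)) => [n|].
  by rewrite /exp_coeff/= !normrM !normrX normr_id.
have e0 n : 0 <= exp_coeff `|x| n by exact: exp_coeff_ge0.
apply/(asum_ltP e0); rewrite -nneseries_esumT//.
rewrite (_ : (fun n => _) = EFin \o series (exp_coeff `|x|)); last first.
  by apply/funext => n; rewrite /= sumEFin.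
by rewrite EFin_lim ?ltry//; exact: is_cvg_series_exp_coeff.
Qed.

Lemma rsum_exp_coeff (x : R) : rsum (exp_coeff x) = expR x.
Proof.
by apply/esym/cvg_lim => //; apply: rsum_series; exact: asum_exp_coeff.
Qed.

End exponential_series.

Section compound_poisson.
Context {R : realType} {G : zmodType} (nu : G -> R).
Hypotheses (nu0 : forall g, 0 <= nu g) (snu : asum nu).
Implicit Types (theta : dual R G) (n : nat) (t : R) (g : G).
Local Notation Re := complex.Re.
Local Notation Im := complex.Im.

Lemma asum_Re theta : asum (fun g => nu g * Re (theta g)).
Proof.
apply: asum_le snu => g; rewrite normrM ler_piMr//; exact: dual_Re_bound.
Qed.

Lemma ft_sym theta : (forall g, nu (- g) = nu g) ->
  ft nu theta = (rsum (fun g => nu g * Re (theta g)))%:C%C.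
Proof.
move=> nuN; have [_ si] := casum_ft theta snu.
have reE g : Re ((nu g)%:C%C * (theta g)^*%C) = nu g * Re (theta g).
  by case: (theta g) => x y /=; rewrite mul0r subr0.
have im0 : rsum (fun g => Im ((nu g)%:C%C * (theta g)^*%C)) = 0.
  have bN : bijective (@GRing.opp G) by exists GRing.opp; exact: opprK.
  (* Replacing [g] by [- g] preserves [nu] and conjugates [theta g], so the sum of imaginary parts
     equals its own opposite. *)
  suff : rsum (fun g => Im ((nu g)%:C%C * (theta g)^*%C)) =
    - rsum (fun g => Im ((nu g)%:C%C * (theta g)^*%C)) by lra.
  rewrite {1}(reindex_rsum _ bN) -rsumN//; congr rsum; apply/funext => g /=.
  by rewrite nuN dualN; case: (theta g) => x y /=; ring.
by rewrite /ft /csum im0; under eq_fun do rewrite reE.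
Qed.

(** Convolution powers of [nu]; the power 0 is the unit mass at 0, the neutral element of
    convolution. *)
Definition convn n : G -> R := iter n (convol nu) (fun g => (g == 0)%:R).

Lemma convn_spec n : (forall g, 0 <= convn n g) /\ asum (convn n).
Proof.
elim: n => [|n [n0 sn]] /=.
  split=> [g|]; first by rewrite ler0n.
  by have [|] := @rsum_single R _ 0 (fun g => (g == 0)%:R) => // g /negbTE ->.
by split; [exact: convol_ge0|exact: asum_convol].
Qed.

Lemma convn_ge0 n g : 0 <= convn n g.
Proof. by have [] := convn_spec n. Qed.

Lemma asum_convn n : asum (convn n).
Proof. by have [] := convn_spec n. Qed.

Lemma ft_convn n theta : ft (convn n) theta = ft nu theta ^+ n.
Proof.
elim: n => [|n ih]; last first.
  by rewrite /= ft_convol ?ih ?exprS//; exact: asum_convn.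
rewrite expr0 /ft /csum.
have [|_ ->] := @rsum_single R _ 0
    (fun g => Re ((convn 0 g)%:C%C * (theta g)^*%C)).
  by move=> g /negbTE g0; rewrite /= g0 mul0r.
have [|_ ->] := @rsum_single R _ 0
    (fun g => Im ((convn 0 g)%:C%C * (theta g)^*%C)).
  by move=> g /negbTE g0; rewrite /= g0 mul0r.
rewrite /= eqxx dual0 /=.
by apply/eqP; rewrite eq_complex/= !mul1r !oppr0 !mul0r !addr0 subr0 !eqxx.
Qed.

Lemma rsum_convn n : rsum (convn n) = rsum nu ^+ n.
Proof.
by apply: complexI; rewrite -ft_dual1 ft_convn ft_dual1 rmorphXn.
Qed.

(** The law at time [t] of the compound Poisson process with jump intensity [nu]. The exponential
    factor normalizes the total mass to 1. *)
Definition cpoisson t g : R :=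
  expR (- t * rsum nu) * rsum (fun n => exp_coeff t n * convn n g).

(** Summing over the group first leaves the exponential series at [t * rsum nu], since the mass of a
    convolution power is the power of the mass. *)
Lemma asum_cpoisson_pair t : 0 <= t ->
  asum (fun z : nat * G => exp_coeff t z.1 * convn z.1 z.2).
Proof.
move=> t0; have e0 n : 0 <= exp_coeff t n by exact: exp_coeff_ge0.
apply: (@asum_pair _ _ _ (fun n g => exp_coeff t n * convn n g)).
  by move=> n; exact/asumZ/asum_convn.
rewrite (_ : (fun n => _) = exp_coeff (t * rsum nu)).
  exact: asum_exp_coeff.
apply/funext => n.
under eq_fun => g do rewrite (ger0_norm (mulr_ge0 (e0 n) (convn_ge0 n g))).
rewrite rsumZ; last exact: asum_convn.
rewrite rsum_convn /exp_coeff/= exprMn. by rewrite mulrAC.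
Qed.

Lemma asum_cpoisson t : 0 <= t -> asum (cpoisson t).
Proof.
move=> t0; apply: asumZ.
by have [] := rsum_pair (reindex_asum (swap_bij _ _) (asum_cpoisson_pair t0)).
Qed.

Lemma cpoisson_ge0 t g : 0 <= t -> 0 <= cpoisson t g.
Proof.
move=> t0; rewrite mulr_ge0 ?expR_ge0//; apply: rsum_ge0 => [n|].
  by rewrite mulr_ge0 ?exp_coeff_ge0 ?convn_ge0.
exact: (asum_sectionl g
  (reindex_asum (swap_bij _ _) (asum_cpoisson_pair t0))).
Qed.

Lemma cpoisson0 g : cpoisson 0 g = (g == 0)%:R.
Proof.
rewrite /cpoisson oppr0 mul0r expR0 mul1r.
have [|_ ->] := @rsum_single R _ 0%N (fun n => exp_coeff 0 n * convn n g).
  by case=> // n _; rewrite /exp_coeff/= expr0n/= !mul0r.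
by rewrite /exp_coeff/= expr0 fact0 divr1 mul1r.
Qed.

Lemma ft_cpoisson t theta : 0 <= t -> (forall g, nu (- g) = nu g) ->
  ft (cpoisson t) theta =
  (expR (- t * rsum (fun g => nu g * (1 - Re (theta g)))))%:C%C.
Proof.
move=> t0 nuN; set c := expR (- t * rsum nu).
pose F (z : G * nat) : R[i] :=
  (exp_coeff t z.2 * convn z.2 z.1)%:C%C * (theta z.1)^*%C.
have sp := reindex_asum (swap_bij G nat) (asum_cpoisson_pair t0).
have sF : casum F by apply: casumM sp _ => z; exact: dual_normJ.
have e1 g : (cpoisson t g)%:C%C * (theta g)^*%C =
    c%:C%C * csum (fun n => F (g, n)).
  rewrite /cpoisson -/c rmorphM/= -mulrA; congr (_ * _).
  rewrite mulrC -csum_real -csumZ; last exact/casum_real/(asum_sectionl g sp).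
  by congr csum; apply/funext => n; rewrite mulrC.
rewrite /ft; under eq_fun do rewrite e1.
rewrite csumZ; last exact: casum_pair sF.
(* With the sum over the group taken first, each convolution power becomes a power of the transform
   of [nu], and the outer sum is an exponential series. *)
rewrite (csum_swap sF).
set z := rsum (fun g => nu g * Re (theta g)).
have e2 n : csum (fun g => F (g, n)) = (exp_coeff (t * z) n)%:C%C.
  rewrite /F/=; under eq_fun do rewrite rmorphM -mulrA.
  rewrite csumZ; last by apply: casum_ft; exact: asum_convn.
  rewrite -/(ft _ _) ft_convn ft_sym// -rmorphXn -rmorphM/=; congr (_%:C)%C.
  by rewrite /exp_coeff/= exprMn mulrAC.
under eq_fun do rewrite e2.
rewrite csum_real rsum_exp_coeff -rmorphM/= -expRD; congr (expR _)%:C%C.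
under [in RHS]eq_fun do rewrite mulrBr mulr1.
by rewrite rsumB//; [rewrite -/z; ring|exact: asum_Re].
Qed.

End compound_poisson.

(** * Probabilities on discrete spaces *)

Section discrete_probability.
Context {R : realType} d (T : measurableType d).
Hypothesis mT : forall E : set T, measurable E.
Implicit Types (P : probability T R) (w : T -> R).

(** Countable additivity is the regrouping of a nonnegative unordered sum along a disjoint union. *)
Lemma probability_of_mass w : (forall x, 0 <= w x) -> asum w -> rsum w = 1 ->
  exists P, forall E, P E = (\esum_(x in E) (w x)%:E)%E.
Proof.
move=> w0 sw w1; pose mu E := (\esum_(x in E) (w x)%:E)%E.
have mu0 : mu set0 = 0%E by rewrite /mu esum_set0.
have mu_ge0 E : (0 <= mu E)%E by apply: esum_ge0 => x _; rewrite lee_fin.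
have mu_sigma : semi_sigma_additive mu.
  move=> F _ tF _; rewrite /mu nneseries_sum_bigcup//.
  by apply: is_cvg_nneseries => n _ _; exact: mu_ge0.
have muT : mu [set: T] = 1%E by rewrite /mu rsumE// w1.
pose mM := isMeasure.Build d T R mu mu0 mu_ge0 mu_sigma.
pose mu' : measure T R := HB.pack mu mM.
pose mP := Measure_isProbability.Build d T R mu' muT.
pose P : probability T R := HB.pack mu mM mP.
by exists P.
Qed.

Definition mass P (x : T) : R := fine (P [set x]).

Lemma massE P x : P [set x] = (mass P x)%:E.
Proof. by rewrite /mass fineK// fin_num_measure. Qed.

Lemma mass_ge0 P x : 0 <= mass P x.
Proof. exact: fine_ge0. Qed.

Let trivIset_singletons (D : set T) : trivIset D set1.
Proof. by move=> x y _ _ [z [-> ->]]. Qed.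

Lemma fsum_mass P (F : set T) : finite_set F ->
  (\sum_(x \in F) (mass P x)%:E = P F)%E.
Proof.
move=> finF; under eq_fsbigr do rewrite -massE.
rewrite -(measure_fsbig P finF (fun _ _ => mT _) (@trivIset_singletons F)).
by rewrite fsbig_setU_set1.
Qed.

(** Finite additivity and monotonicity bound each finite partial sum by the probability of [E]. *)
Lemma esum_mass_le P (E : set T) :
  (\esum_(x in E) (mass P x)%:E <= P E)%E.
Proof.
apply: ge_ereal_sup => _ [F [finF FE] <-].
by rewrite fsum_mass// le_measure ?inE.
Qed.

Lemma asum_mass P : asum (mass P).
Proof.
apply/(asum_ltP (mass_ge0 P)); apply: (le_lt_trans (esum_mass_le P _)).
by rewrite probability_setT ltry.
Qed.

(* Over an uncountable discrete space a probability may have a diffuse part;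
   it has none as soon as the masses of the points add up to 1. *)
Lemma probability_atomic P : rsum (mass P) = 1 ->
  forall E, P E = (\esum_(x in E) (mass P x)%:E)%E.
Proof.
move=> P1 E; apply/eqP; rewrite eq_le esum_mass_le andbT.
(* The lower bounds for [E] and its complement add up to 1, as do the two probabilities, so neither
   bound can be strict. *)
have : (\esum_(x in E) (mass P x)%:E + \esum_(x in ~` E) (mass P x)%:E = 1)%E.
  rewrite -P1 -rsumE; [|exact: mass_ge0|exact: asum_mass].
  rewrite [RHS](esumID E) ?setTI// => x _; rewrite lee_fin; exact: mass_ge0.
have := esum_mass_le P (~` E).
rewrite probability_setC//.
have fE (S : set T) : (\esum_(x in S) (mass P x)%:E \is a fin_num)%E.
  rewrite ge0_fin_numE ?esum_ge0// => [|x _]; last by rewrite lee_fin mass_ge0.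
  rewrite (le_lt_trans (esum_mass_le P _))//.
  by rewrite (le_lt_trans (probability_le1 _ _))// ltry.
rewrite -(fineK (fE E)) -(fineK (fE (~` E))).
rewrite -(fineK (fin_num_measure P E (mT E))).
by rewrite -EFinB -EFinD !lee_fin => + -[]; lra.
Qed.

Let mfT (D : set T) (f : T -> \bar R) : measurable_fun D f.
Proof. by move=> _ Y _; exact: mT. Qed.

(** Each finite partial sum is the integral of [f] over a finite set of points. *)
Lemma esum_mass_integral_le P (f : T -> \bar R) : (forall x, 0 <= f x)%E ->
  (\esum_(x in [set: T]) ((mass P x)%:E * f x) <= \int[P]_x f x)%E.
Proof.
move=> f0; apply: ge_ereal_sup => _ [F [finF _] <-].
rewrite fsbig_finite//=.
apply: (@le_trans _ _
    (\int[P]_(x in \big[setU/set0]_(y <- fset_set F) [set y]) f x)%E).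
  rewrite (@ge0_integral_bigsetU _ _ _ P _ set1 f _ (fun _ => mT _)
    (fset_uniq _) (@trivIset_singletons _) (@mfT _ _) (fun x _ => f0 x)).
  apply: lee_sum => x _.
  rewrite (eq_integral (cst (f x))); last by move=> y; rewrite inE => ->.
  by rewrite integral_cst// -massE muleC.
exact: ge0_subset_integral.
Qed.

(* [esum_mass_integral_le] applied to both [f] and [1 - f]. *)
Lemma integral_atomic P (f : T -> \bar R) : rsum (mass P) = 1 ->
  (forall x, 0 <= f x <= 1)%E ->
  (\int[P]_x f x = \esum_(x in [set: T]) ((mass P x)%:E * f x))%E.
Proof.
move=> P1 f01; apply/eqP.
rewrite eq_le esum_mass_integral_le ?andbT; last first.
  by move=> x; have /andP[] := f01 x.
have f0 x : (0 <= f x)%E by have /andP[] := f01 x.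
have f1 x : (f x <= 1)%E by have /andP[] := f01 x.
have fin x : f x \is a fin_num.
  by rewrite ge0_fin_numE// (le_lt_trans (f1 x))// ltry.
have g0 x : (0 <= 1 - f x)%E by rewrite sube_ge0// fin.
have wx0 x : (0 <= (mass P x)%:E)%E by rewrite lee_fin mass_ge0.
have := esum_mass_integral_le P g0.
have : (\int[P]_x f x + \int[P]_x (1 - f x) = 1)%E.
  rewrite -ge0_integralD//.
  under eq_integral do rewrite addeCA subee// adde0.
  by rewrite integral_cst// mul1e; exact: probability_setT.
have : (\esum_(x in [set: T]) ((mass P x)%:E * f x) +
    \esum_(x in [set: T]) ((mass P x)%:E * (1 - f x)) = 1)%E.
  rewrite -esumD => [|x _|x _]; last 2 first.
  - by rewrite mule_ge0.
  - by rewrite mule_ge0.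
  rewrite -[in RHS]P1 -rsumE; [|exact: mass_ge0|exact: asum_mass].
  apply: eq_esum => x _; rewrite -ge0_muleDr//.
  by rewrite addeCA subee// adde0 mule1.
have ints : (0 <= \int[P]_x f x)%E by exact: integral_ge0.
have ints' : (0 <= \int[P]_x (1 - f x))%E by exact: integral_ge0.
have sums : (0 <= \esum_(x in [set: T]) ((mass P x)%:E * f x))%E.
  by apply: esum_ge0 => x _; rewrite mule_ge0.
have sums' : (0 <= \esum_(x in [set: T]) ((mass P x)%:E * (1 - f x)))%E.
  by apply: esum_ge0 => x _; rewrite mule_ge0.
move: ints ints' sums sums'.
move: (\int[P]_x f x)%E (\int[P]_x (1 - f x))%E => a b.
move: (\esum_(x in _) (_ * f x))%E (\esum_(x in _) (_ * (1 - f x)))%E => c e.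
(* Nonnegative terms with sum 1 are finite. Then [a + b = 1], [c + e = 1] and [e <= b] give
   [a <= c]. *)
case: a => [a||]; case: b => [b||]; case: c => [c||]; case: e => [e||] //.
by rewrite !lee_fin => _ _ _ _ [] ce [] ab; lra.
Qed.

End discrete_probability.

(** * The metric pair *)

Section KXA_characters.
Context {R : realType} {X : metricType R} (A : set X).
Implicit Types (kappa g : KXA A) (x : ~` A).

(** The character [exp(i c n)], where [n] is the coordinate of [g] at [x]. *)
Definition rotation (c : R) x : KXA A -> R[i] := fun g =>
  Complex (cos (c * (freeg.coeff x g)%:~R)) (sin (c * (freeg.coeff x g)%:~R)).

Lemma rotationD c x g h :
  rotation c x (g + h) = rotation c x g * rotation c x h.
Proof.
rewrite /rotation coeffD intrD mulrDr cosD sinD.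
by apply/eqP; rewrite eq_complex/= eqxx/= addrC [_ * cos _]mulrC.
Qed.

Lemma rotation_norm c x g : `|rotation c x g| = 1.
Proof. by rewrite normc_def/= cos2Dsin2 sqrtr1. Qed.

Lemma KXA_separating : @separating_dual R (KXA A).
Proof.
move=> g g0; have [x xg] : exists x, freeg.coeff x g != 0.
  apply: contrapT => h; case/negP: g0; apply/freeg_eqP => x.
  rewrite coeff0; apply/eqP; apply: contrapT => /negP xg.
  by apply: h; exists x.
(* Dividing [pi] by the nonzero coordinate of [g] at [x] makes the angle at [g] equal to [pi]. *)
exists (Dual (rotationD (pi / (freeg.coeff x g)%:~R) x) (rotation_norm _ _)).
rewrite /= /rotation divfK ?intr_eq0// cospi sinpi.
by apply/eqP; rewrite eq_complex/= oppr0 !eqxx.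
Qed.

End KXA_characters.

(** * The jump measure [nu] and the exponent [lambda] *)

Section levy_measure.
Context {R : realType} {X : metricType R} (A : set X) (psi : R -> R).
Hypotheses (A0 : A !=set0) (psi_ge0 : forall r : R, 0 <= r -> 0 <= psi r).
Hypothesis psi_sum :
  (\esum_(xy in [set xy : (~` A) * (~` A) | xy.1 <> xy.2])
    (psi (d1bar (Some xy.1) (Some xy.2)))%:E < +oo)%E.
Local Notation nu := (@nu R X A psi).

Lemma d1bar_ge0 (u v : collapse A) : 0 <= d1bar u v.
Proof.
case: u v => [x|] [y|] //=; last 2 first.
- exact: dist_to_ge0.
- exact: dist_to_ge0.
by rewrite /d1 le_min mdist_ge0/= addr_ge0// dist_to_ge0.
Qed.

Lemma d1barC (u v : collapse A) : d1bar u v = d1bar v u.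
Proof. by case: u v => [x|] [y|] //=; rewrite /d1 metric_sym addrC. Qed.

Lemma nu_cases (kappa : KXA A) :
  (exists x y : ~` A, x <> y /\ kappa = Defs.basis x - Defs.basis y) \/
  (forall x y : ~` A, x <> y -> kappa <> Defs.basis x - Defs.basis y).
Proof.
have [h|h] := pselect
  (exists x y : ~` A, x <> y /\ kappa = Defs.basis x - Defs.basis y).
  by left.
by right => x y xy e; apply: h; exists x, y.
Qed.

Lemma nu_ge0 kappa : 0 <= nu kappa.
Proof.
have [[x [y [xy ->]]]|/nu_eq0 ->//] := nu_cases kappa.
by rewrite nu_basisB// mulr_ge0 ?invr_ge0 ?ler0n// psi_ge0// d1bar_ge0.
Qed.

Lemma nuN kappa : nu (- kappa) = nu kappa.
Proof.
have [[x [y [xy ->]]]|h] := nu_cases kappa.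
  by rewrite opprB !nu_basisB 1?d1barC//; exact: nesym.
rewrite !nu_eq0// => x y xy e.
apply: (h y x); first exact: nesym.
by rewrite -(opprK kappa) e opprB.
Qed.

(** The support of [nu] lies in the image of the off-diagonal pairs under the difference of basis
    vectors, which is injective there. Reindexing turns the total mass into half the sum of [psi]
    over those pairs. *)
Lemma asum_nu : asum nu.
Proof.
apply/(asum_ltP nu_ge0).
pose S := [set xy : (~` A) * (~` A) | xy.1 <> xy.2].
pose b (xy : (~` A) * (~` A)) : KXA A := Defs.basis xy.1 - Defs.basis xy.2.
have -> : (\esum_(k in [set: KXA A]) (nu k)%:E =
    \esum_(k in b @` S) (nu k)%:E)%E.
  rewrite [RHS]esum_mkcond; apply: eq_esum => k _.
  case: ifPn => // /negP kS; rewrite nu_eq0// => x y xy e.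
  by apply: kS; rewrite inE; exists (x, y).
rewrite esum_image; last first.
  move=> [x y] [x' y']; rewrite !inE => xy _ /(basisB_inj xy)[/= -> ->] //.
rewrite (eq_esum (b := fun xy : (~` A) * (~` A) =>
    (2^-1 * psi (d1bar (Some xy.1) (Some xy.2)))%:E)); last first.
  by move=> [x y] xy; rewrite /b nu_basisB.
rewrite esumZl ?invr_ge0// => [|xy]; last by rewrite psi_ge0// d1bar_ge0.
exact: lte_mul_pinfty.
Qed.

Lemma lambdaE (theta : dual R (KXA A)) :
  lambda psi theta =
  rsum (fun kappa => nu kappa * (1 - complex.Re (theta kappa))).
Proof.
have f0 k : 0 <= nu k * (1 - complex.Re (theta k)).
  rewrite mulr_ge0 ?nu_ge0// subr_ge0.
  by have := dual_Re_bound theta k; rewrite ler_norml => /andP[].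
have sf : asum (fun k => nu k * (1 - complex.Re (theta k))).
  under eq_fun do rewrite mulrBr mulr1.
  by apply: asumB; [exact: asum_nu|apply: asum_Re => //; exact: asum_nu].
rewrite -[RHS]/(fine (rsum _)%:E) -rsumE//; congr fine.
(* The index 0, excluded from [lambda], contributes nothing because every character takes the value
   1 there. *)
rewrite [LHS]esum_mkcond; apply: eq_esum => k _.
case: ifPn => //; rewrite notin_setE/= => /negP; rewrite negbK => /eqP ->.
by rewrite dual0 subrr mulr0.
Qed.

End levy_measure.

(** * Fourier transform and convolution expressed through point masses *)

Section fourier_of_probability.
Context {R : realType} {X : metricType R} {A : set X}.
Implicit Types (p q : probability (KXA A) R) (theta : dual R (KXA A)).

Lemma KXA_measurable (E : set (KXA A)) : measurable E.
Proof. by []. Qed.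

Lemma fourierE p theta : fourier p theta = ft (mass p) theta.
Proof. exact: (csum_lim (casum_ft theta (asum_mass KXA_measurable p))). Qed.

(** Atomicity of [p] turns the integral into a sum, atomicity of [q] expands the measure of each
    translated set, and Tonelli exchanges the two sums. *)
Lemma convolution_atomic p q (E : set (KXA A)) :
  rsum (mass p) = 1 -> rsum (mass q) = 1 ->
  convolution p q E = (\esum_(k in E) (convol (mass p) (mass q) k)%:E)%E.
Proof.
move=> p1 q1; rewrite /convolution integral_atomic//; last first.
  by move=> g; rewrite measure_ge0 probability_le1.
have p0 := mass_ge0 p; have q0 := mass_ge0 q.
have sp := asum_mass KXA_measurable p; have sq := asum_mass KXA_measurable q.
pose F (g k : KXA A) : \bar R :=
  if k \in E then (mass p g * mass q (k - g))%:E else 0%E.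
have F0 g k : (0 <= F g k)%E.
  by rewrite /F; case: ifP => // _; rewrite lee_fin mulr_ge0.
transitivity (\esum_(g in [set: KXA A]) \esum_(k in [set: KXA A]) F g k)%E.
  apply: eq_esum => g _.
  rewrite (probability_atomic KXA_measurable q1).
  (* The substitution [k = g + h] turns the condition on [h] into membership of [k] in [E]. *)
  rewrite -esumZl// (reindex_esum [set: KXA A] [set: KXA A] (+%R g)).
    rewrite esum_mkcond; apply: eq_esum => h _.
    have -> : (h \in [set h | E (g + h)]) = (g + h \in E).
      by apply/idP/idP; rewrite !inE.
    by rewrite /F [g + h - g]addrAC subrr add0r.
  by rewrite setTT_bijective; exists (+%R (- g)) => h; rewrite ?addKr ?addNKr.
rewrite esum_swap// [RHS]esum_mkcond; apply: eq_esum => k _.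
rewrite /F; case: ifPn => kE; last by rewrite esum1.
rewrite rsumE//; first by move=> g; rewrite mulr_ge0.
exact: (asum_sectionl k (asum_convol_pair sp sq)).
Qed.

End fourier_of_probability.

(** * Existence and uniqueness of the semigroup with exponent [lambda] *)

Theorem theorem8 (R : realType) (X : metricType R) (A : set X)
    (A0 : A !=set0) (Adiscrete : uniformly_discrete A)
    (psi : R -> R) (psi_ge0 : forall r : R, 0 <= r -> 0 <= psi r)
    (psi0 : psi 0 = 0)
    (psi_sum : (\esum_(xy in [set xy : (~` A) * (~` A) | xy.1 <> xy.2])
      (psi (d1bar (Some xy.1) (Some xy.2)))%:E < +oo)%E) :
  let is_solution (p : {nonneg R} -> probability (KXA A) R) :=
    convolution_semigroup p /\
    forall (t : {nonneg R}) (theta : dual R (KXA A)),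
      fourier (p t) theta = (expR (- t%:num * lambda psi theta))%:C%C in
  exists p : {nonneg R} -> probability (KXA A) R,
    is_solution p /\
    forall q : {nonneg R} -> probability (KXA A) R,
      is_solution q -> forall (t : {nonneg R}) (E : set (KXA A)),
        q t E = p t E.
Proof.
move=> is_solution.
have nu0 := nu_ge0 A0 psi_ge0; have snu := asum_nu A0 psi_ge0 psi_sum.
have lamE := lambdaE A0 psi_ge0 psi_sum.
pose w (t : {nonneg R}) : KXA A -> R := cpoisson (nu psi) t%:num.
have w0 t g : 0 <= w t g by exact: cpoisson_ge0.
have sw t : asum (w t) by exact: asum_cpoisson.
have ftw t theta : ft (w t) theta = (expR (- t%:num * lambda psi theta))%:C%C.
  by rewrite ft_cpoisson// ?lamE//; exact: nuN.
(* The exponent vanishes at the trivial character, so each [w t] has total mass 1. *)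
have lam1 : lambda psi (dual1 : dual R (KXA A)) = 0.
  rewrite lamE (_ : (fun _ => _) = fun=> 0).
    by have [_ ->] := @rsum_single R (KXA A) 0 (fun=> 0) (fun _ _ => erefl).
  by apply/funext => k; rewrite /= subrr mulr0.
have w1 t : rsum (w t) = 1.
  by apply: complexI; rewrite -ft_dual1 ftw lam1 mulr0 expR0.
have /choice[p pE] t : exists P : probability (KXA A) R,
    forall E, P E = (\esum_(g in E) (w t g)%:E)%E.
  exact: probability_of_mass (w0 t) (sw t) (w1 t).
have pw t : mass (p t) = w t.
  by apply/funext => g; rewrite /mass pE esum_set1// lee_fin.
exists p; split; last first.
  move=> q [_ qF] t E.
  have sq := asum_mass (@KXA_measurable R X A) (q t).
  (* At the trivial character this says that [q t] is purely atomic. *)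
  have qw : mass (q t) = w t.
    apply: (ft_inj (@KXA_separating R X A)) => //.
      exact: mass_ge0.
    by move=> theta; rewrite -fourierE qF ftw.
  have q1 : rsum (mass (q t)) = 1 by rewrite qw.
  by rewrite (probability_atomic (@KXA_measurable R X A) q1) pE qw.
split; last by move=> t theta; rewrite fourierE pw ftw.
split=> [E|s t E].
  rewrite pE diracE.
  have e g : w 0%:nng g = (g == 0)%:R by rewrite /w/= cpoisson0.
  rewrite esum_mkcond (@esum_single _ _ 0) => [|g|g /negbTE g0].
  - by rewrite e eqxx; case: (0 \in E).
  - by case: ifP => // _; rewrite lee_fin.
  - by rewrite e g0; case: ifP.
rewrite convolution_atomic ?pw// pE; apply: eq_esum => k _; congr (_%:E).
(* It remains to compare transforms: the product of the exponentials at [s] and [t] is the one at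
   [s + t]. *)
apply: (congr1 (@^~ k)); apply: (ft_inj (@KXA_separating R X A)) => //.
- exact: convol_ge0.
- exact: asum_convol.
- move=> theta; rewrite ft_convol// !ftw/= -rmorphM/= -expRD.
  by rewrite opprD mulrDl.
Qed.
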